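(* Let $K$ be the ring of formal power series of bounded degree in $x_1,x_2,\dots$ with integer coefficients. Suppose $f\in\mathrm{QSym}$ and $f=\prod_i f_i$ is a factorization of $f$ into irreducible elements of $K$. Then $f_i\in\mathrm{QSym}$ for every $i$.
   Context: $\mathrm{QSym}\subseteq K$ is the subring of quasi-symmetric functions: $f\in K$ such that the coefficient of $x_{i_1}^{a_1}\cdots x_{i_k}^{a_k}$ equals that of $x_{j_1}^{a_1}\cdots x_{j_k}^{a_k}$ whenever $i_1<\dots<i_k$ and $j_1<\dots<j_k$ (for all positive $a_1,\dots,a_k$). The units of $K$ are $\pm1$. *)

(* Defs.v *)
From mathcomp Require Import all_boot all_order all_algebra.
Set Implicit Arguments. Unset Strict Implicit. Unset Printing Implicit Defensive.
Import Order.TTheory GRing.Theory Num.Theory.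
Local Open Scope ring_scope.

(* Monomials in x_1, x_2, ... are represented by exponent sequences
   m = [:: a_1; a_2; ...; a_n] standing for x_1^a_1 ... x_n^a_n; sequences
   differing by trailing zeros represent the same monomial. *)
Definition monom := seq nat.

Definition mdeg (m : monom) : nat := sumn m.

Definition series := monom -> int.

(* Membership in K: coefficients are well defined on monomials (invariant
   under trailing zeros) and the degree is bounded. *)
Definition inK (f : series) : Prop :=
  (forall m, f (rcons m 0%N) = f m) /\
  (exists D : nat, forall m, (D < mdeg m)%N -> f m = 0).

Fixpoint divs (m : monom) : seq monom :=
  match m with
  | [::] => [:: [::]]
  | a :: m' => [seq i :: d | i <- iota 0 a.+1, d <- divs m']
  end.

Definition msub (m d : monom) : monom := [seq (x.1 - x.2)%N | x <- zip m d].

Definition zeroK : series := fun _ => 0.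
Definition oneK : series := fun m => if mdeg m == 0%N then 1 else 0.
Definition mulK (f g : series) : series :=
  fun m => \sum_(d <- divs m) f d * g (msub m d).
Definition prodK (fs : seq series) : series := foldr mulK oneK fs.

Definition eqK (f g : series) : Prop := forall m, f m = g m.

Definition unitK (f : series) : Prop :=
  inK f /\ exists g, inK g /\ eqK (mulK f g) oneK.

Definition irreducibleK (f : series) : Prop :=
  [/\ inK f, ~ eqK f zeroK, ~ unitK f &
      forall g h, inK g -> inK h -> eqK f (mulK g h) -> unitK g \/ unitK h].

(* Quasi-symmetric: the coefficient of x_{i_1}^{a_1}...x_{i_k}^{a_k}
   (i_1 < ... < i_k, a_j > 0) depends only on (a_1,...,a_k), i.e. on the
   sequence of nonzero exponents in order. *)
Definition QSym (f : series) : Prop :=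
  inK f /\
  forall m1 m2 : monom,
    [seq a <- m1 | a != 0%N] = [seq a <- m2 | a != 0%N] -> f m1 = f m2.

(* Main.v *)
Require Import Defs.
From mathcomp Require Import all_boot all_order all_algebra.
From mathcomp Require Import boolp.

(* A series is quasi-symmetric iff it is fixed by every substitution s_k that
   sets x_k to 0 and renumbers the later variables.  In fact every divisor g in
   K of a nonzero quasi-symmetric f is quasi-symmetric.  Let F_n and G_n be the
   truncations of f and g to n variables; then s_k F_(n+1) = F_n for all k.  For
   n large the total degree of F_n is constant, so s_k sends no nonunit divisor
   of F_(n+1) to a unit.  Hence, by unique factorization in Z[x_1, ..., x_n], the
   sum of the squared multiplicities of the primes of F_n is nonincreasing in n.
   Once it is constant, s_k sends distinct primes of F_(n+1) to distinct primes,
   so it is injective on the divisors of F_(n+1).  Now s_k G_(n+1) = G_n follows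
   by descending induction on k: for k = n + 1 it is the definition of the
   truncation, and s_k s_k G_(n+1) = s_k s_(k+1) G_(n+1) = s_k G_n, where s_k can
   be cancelled. *)

Set Implicit Arguments. Unset Strict Implicit. Unset Printing Implicit Defensive.
Import Order.TTheory GRing.Theory Num.Theory.
Local Open Scope ring_scope.

(** * Unique factorization *)

Definition divides (R : idomainType) (a b : R) := exists c, b = c * a.

Definition prime_elt (R : idomainType) (p : R) :=
  [/\ p != 0, p \isn't a GRing.unit &
      forall a b, divides p (a * b) -> divides p a \/ divides p b].

Definition assoc (R : idomainType) (a b : R) :=
  exists2 u, u \is a GRing.unit & b = u * a.

Definition prime_fact (R : idomainType) (a : R) :=
  exists2 ps : seq R, (forall p, p \in ps -> prime_elt p) &
                      assoc (\prod_(p <- ps) p) a.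

Definition ufd (R : idomainType) := forall a : R, a != 0 -> prime_fact a.

Section Divides.
Variable R : idomainType.
Implicit Types a b c p : R.

Lemma divides_refl a : divides a a.
Proof. by exists 1; rewrite mul1r. Qed.

Lemma divides_mulr a b c : divides a b -> divides a (b * c).
Proof. by move=> [d ->]; exists (d * c); rewrite mulrAC. Qed.

Lemma divides_mull a b c : divides a b -> divides a (c * b).
Proof. by rewrite mulrC; apply: divides_mulr. Qed.

Lemma divides_trans a b c : divides a b -> divides b c -> divides a c.
Proof. by move=> ab [d ->]; apply: divides_mull. Qed.

Lemma dividesD a b c : divides a b -> divides a c -> divides a (b + c).
Proof. by move=> [d ->] [e ->]; exists (d + e); rewrite mulrDl. Qed.

Lemma dividesN a b : divides a b -> divides a (- b).
Proof. by move=> [d ->]; exists (- d); rewrite mulNr. Qed.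

Lemma divides_unit a b : divides a b -> b \is a GRing.unit -> a \is a GRing.unit.
Proof. by move=> [d ->]; rewrite unitrM => /andP[]. Qed.

Lemma assoc_refl a : assoc a a.
Proof. by exists 1; rewrite ?unitr1 ?mul1r. Qed.

Lemma assoc_sym a b : assoc a b -> assoc b a.
Proof. by move=> [u uu ->]; exists u^-1; rewrite ?unitrV ?mulKr. Qed.

Lemma assoc_trans b a c : assoc a b -> assoc b c -> assoc a c.
Proof.
move=> [u uu ->] [v uv ->].
by exists (v * u); rewrite ?unitrM ?uu ?uv ?mulrA.
Qed.

Lemma assocM a b a' b' : assoc a b -> assoc a' b' -> assoc (a * a') (b * b').
Proof.
by move=> [u uu ->] [v uv ->]; exists (u * v); rewrite ?unitrM ?uu ?uv // mulrACA.
Qed.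

Lemma assoc_divides a b : assoc a b -> divides a b.
Proof. by move=> [u _ ->]; exists u. Qed.

Lemma prime_assoc p q : prime_elt p -> prime_elt q -> divides p q -> assoc p q.
Proof.
move=> [p0 pu _] [q0 qu qp] [c def_q].
have [|[d def_c]|[d def_p]] := qp c p; first by rewrite -def_q; apply: divides_refl.
  case/negP: pu; apply: (@divides_unit _ 1); last exact: unitr1.
  exists d; apply: (mulIf q0).
  by rewrite mul1r mulrAC -def_c.
exists c => //; apply: (@divides_unit _ 1); last exact: unitr1.
exists d; apply: (mulIf p0).
by rewrite mul1r -mulrA -def_q.
Qed.

Lemma prime_fact1 p : prime_elt p -> prime_fact p.
Proof.
move=> pp; exists [:: p] => [r|]; first by rewrite inE => /eqP->.
by rewrite big_seq1; apply: assoc_refl.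
Qed.

Lemma prime_factM a b : prime_fact a -> prime_fact b -> prime_fact (a * b).
Proof.
move=> [s ps sa] [t pt tb]; exists (s ++ t).
  by move=> r; rewrite mem_cat => /orP[/ps|/pt].
by rewrite big_cat; apply: assocM.
Qed.

Lemma prime_divides_prod p (s : seq R) :
  prime_elt p -> divides p (\prod_(q <- s) q) -> exists2 q, q \in s & divides p q.
Proof.
move=> pp; elim: s => [|q s IH].
  rewrite big_nil => d1; case: pp => _ /negP[]; exact: divides_unit d1 (unitr1 _).
rewrite big_cons; case: (pp) => _ _ /[apply] -[pq|/IH[r rs pr]].
  by exists q; rewrite ?mem_head.
by exists r; rewrite // in_cons rs orbT.
Qed.

Lemma prime_assoc_prime p q : assoc p q -> prime_elt p -> prime_elt q.
Proof.
move=> pq [p0 pu pP]; have [u uu def_q] := pq; split.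
- by rewrite def_q mulf_neq0 //; apply: contraTneq uu => ->; rewrite unitr0.
- by rewrite def_q unitrM uu.
- move=> a b qab; have [|pa|pb] := pP a b.
  + exact: divides_trans (assoc_divides pq) qab.
  + by left; apply: divides_trans pa; apply: assoc_divides; apply: assoc_sym.
  + by right; apply: divides_trans pb; apply: assoc_divides; apply: assoc_sym.
Qed.

(* A canonical representative in each class of associates turns uniqueness of
   factorization into [perm_eq]. *)
Definition nf p := choose (fun q => `[< assoc p q >]) p.

Lemma nfP p : assoc p (nf p).
Proof.
apply/asboolP/(chooseP (P := fun q => `[< assoc p q >])).
exact/asboolP/assoc_refl.
Qed.

Lemma nf_assoc p q : assoc p q -> nf p = nf q.
Proof.
move=> pq; rewrite /nf (@eq_choose _ _ (fun r => `[< assoc q r >])).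
  by apply: choose_id; apply/asboolP; [apply: assoc_sym | apply: assoc_refl].
move=> r; apply/asboolP/asboolP => h; first exact: assoc_trans (assoc_sym pq) h.
exact: assoc_trans h.
Qed.

Lemma nf_idem p : nf (nf p) = nf p.
Proof. exact/esym/nf_assoc/nfP. Qed.

Definition nprime p := prime_elt p /\ nf p = p.

Lemma nprime_divides p q : nprime p -> nprime q -> divides p q -> p = q.
Proof.
move=> [pp np] [pq nq] /(prime_assoc pp pq) /nf_assoc.
by rewrite np nq.
Qed.

(** The first prime of [s] divides a member of [t], hence equals it since both are normalized; it is
    cancelled on both sides. *)
Lemma nprime_fact_uniq (s t : seq R) :
  (forall p, p \in s -> nprime p) -> (forall p, p \in t -> nprime p) ->
  assoc (\prod_(p <- s) p) (\prod_(p <- t) p) -> perm_eq s t.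
Proof.
elim: s t => [|p s IH] t hs ht.
  rewrite big_nil => -[u uu]; rewrite mulr1; case: t ht => // q t ht.
  rewrite big_cons => def_u; have [[_ qu _] _] := ht q (mem_head _ _).
  by case/negP: qu; move: uu; rewrite -def_u unitrM => /andP[].
move=> st; have np := hs _ (mem_head _ _).
have [|q qt pq] := @prime_divides_prod p t np.1.
  apply: divides_trans (assoc_divides st).
  by rewrite big_cons; apply/divides_mulr/divides_refl.
have := nprime_divides np (ht _ qt) pq => epq; rewrite -epq in qt.
rewrite perm_sym (perm_trans (perm_to_rem qt)) // perm_cons perm_sym.
apply: IH => [r rs|r /mem_rem|]; [|exact: ht|].
  by apply: hs; rewrite in_cons rs orbT.
move: st; rewrite big_cons (perm_big _ (perm_to_rem qt)) big_cons /= => -[u uu].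
rewrite mulrCA => /mulfI e; exists u => //; apply: e; by case: np => -[].
Qed.

End Divides.

Section UFD.
Variable R : idomainType.
Hypothesis ufdR : ufd R.
Implicit Types a b c p : R.

Lemma nprime_fact a : a != 0 -> exists s : seq R,
  (forall p, p \in s -> nprime p) /\ assoc (\prod_(p <- s) p) a.
Proof.
move=> /ufdR[s ps sa]; exists (map (@nf R) s); split.
  move=> _ /mapP[p /ps pp ->]; split; last exact: nf_idem.
  exact: prime_assoc_prime (nfP p) pp.
apply: assoc_trans sa; elim: s {ps} => [|p s IH]; first exact: assoc_refl.
by rewrite /= !big_cons; apply: assocM => //; apply/assoc_sym/nfP.
Qed.

(** A chosen normalized factorization, unique up to permutation by [nprime_fact_uniq]. The empty
    list at 0 is a default. *)
Definition pfact a : seq R :=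
  if pselect (a != 0) is left a0 then projT1 (cid (nprime_fact a0)) else [::].

Lemma pfact_nprime a p : p \in pfact a -> nprime p.
Proof. by rewrite /pfact; case: pselect => // a0; case: cid => s [/= + _]; apply. Qed.

Lemma pfact_prod a : a != 0 -> assoc (\prod_(p <- pfact a) p) a.
Proof. by rewrite /pfact; case: pselect => // a0 _; case: cid => s [/=]. Qed.

Lemma pfact_assoc a b : a != 0 -> b != 0 -> perm_eq (pfact a) (pfact b) -> assoc a b.
Proof.
move=> a0 b0 ab; apply: assoc_trans (pfact_prod b0); apply: assoc_sym.
by rewrite -(perm_big _ ab); apply: pfact_prod.
Qed.

Lemma pfactM a b : a != 0 -> b != 0 -> perm_eq (pfact (a * b)) (pfact a ++ pfact b).
Proof.
move=> a0 b0; apply: nprime_fact_uniq.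
- exact: pfact_nprime.
- by move=> p; rewrite mem_cat => /orP[]; apply: pfact_nprime.
- rewrite big_cat /=; apply: (assoc_trans (pfact_prod (mulf_neq0 a0 b0))).
  by apply: assoc_sym; apply: assocM; apply: pfact_prod.
Qed.

Lemma pfact_unit u : u \is a GRing.unit -> pfact u = [::].
Proof.
move=> uu; have u0 : u != 0 by apply: contraTneq uu => ->; rewrite unitr0.
have [v _ def_u] := pfact_prod u0; move: uu; rewrite {1}def_u unitrM => /andP[_].
case: (pfact u) (@pfact_nprime u) => // p s /(_ p (mem_head _ _))[[_ pu _] _].
by rewrite big_cons unitrM (negPf pu).
Qed.

Lemma pfact_nonunit a : a != 0 -> a \isn't a GRing.unit -> pfact a != [::].
Proof.
move=> a0; apply: contra => /eqP e; have [u uu ->] := pfact_prod a0.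
by rewrite e big_nil mulr1.
Qed.

Lemma pfact_divides a p : a != 0 -> p \in pfact a -> divides p a.
Proof.
move=> a0 pa; apply: divides_trans (assoc_divides (pfact_prod a0)).
by rewrite (perm_big _ (perm_to_rem pa)) big_cons; apply/divides_mulr/divides_refl.
Qed.

(** Induction on the number of prime factors, used below to strip a constant of its primes one at a
    time. *)
Lemma ufd_ind (P : R -> Prop) :
  (forall u, u \is a GRing.unit -> P u) ->
  (forall p a, prime_elt p -> a != 0 -> P a -> P (a * p)) ->
  forall a, a != 0 -> P a.
Proof.
move=> Pu Pp a a0; have [s ps [u uu ->]] := ufdR a0.
elim: s ps => [|p s IH] ps; first by rewrite big_nil mulr1; apply: Pu.
rewrite big_cons mulrCA mulrC; apply: Pp.
- exact/ps/mem_head.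
- rewrite mulf_neq0 //; first by apply: contraTneq uu => ->; rewrite unitr0.
  rewrite prodf_seq_neq0; apply/allP => q qs /=.
  by have [] := ps q; rewrite // in_cons qs orbT.
- by apply: IH => q qs; apply: ps; rewrite in_cons qs orbT.
Qed.

End UFD.

(** * Gauss's lemma and polynomial rings over a factorial ring *)

Section UFDPoly.
Variable R : idomainType.
Hypothesis ufdR : ufd R.
Implicit Types (a b q : {poly R}) (c p : R).

Lemma divides_polyC p q : divides p%:P q -> forall i, divides p q`_i.
Proof. by move=> [a -> i]; exists a`_i; rewrite coefMC. Qed.

(** Constant terms divisible by [p] are stripped off the factors in turn. If that of the first
    factor is not divisible by [p], that of the second is, because [p] divides their product. *)
Lemma prime_polyC p : prime_elt p -> prime_elt p%:P.
Proof.
move=> [p0 pu pP]; split; first by rewrite polyC_eq0.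
  by rewrite poly_unitE coefC eqxx negb_and pu orbT.
have divC (c : R) : divides p c -> divides p%:P c%:P.
  by move=> [d ->]; exists d%:P; rewrite polyCM.
have divX a c b : divides p c -> divides p%:P ((a * 'X + c%:P) * b) ->
    divides p%:P (a * b).
  move=> /divC pc; rewrite mulrDl => pab.
  have /divides_polyC h : divides p%:P (a * b * 'X).
    rewrite mulrAC -[X in divides _ X](addrK (c%:P * b)).
    by apply: dividesD => //; apply/dividesN/divides_mulr.
  have {}h i : {d | (a * b)`_i = d * p}.
    by apply: cid; have := h i.+1; rewrite coefMX.
  exists (\poly_(i < size (a * b)) projT1 (h i)); apply/polyP => i.
  rewrite coefMC coef_poly; case: ltnP => [_|le]; first by case: (h i).
  by rewrite nth_default // mul0r.
have divD a c : divides p c -> divides p%:P a -> divides p%:P (a * 'X + c%:P).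
  by move=> /divC pc pa; apply: dividesD => //; apply: divides_mulr.
elim/poly_ind => [|a c IHa] b; first by left; exists 0; rewrite mul0r.
have [pc|npc] := EM (divides p c).
  by move=> /(divX _ _ _ pc)/IHa[pa|]; [left; apply: divD | right].
elim/poly_ind: b => [|b d IHb]; first by right; exists 0; rewrite mul0r.
move=> pab; have pd : divides p d.
  have := divides_polyC pab 0; rewrite coef0M !coefD !coefMX !coefC !eqxx !add0r.
  by case/pP.
move: pab; rewrite mulrC => /(divX _ _ _ pd); rewrite mulrC => /IHb[|pb].
  by left.
by right; apply: divD.
Qed.

Lemma unit_polyC (c : R) : (c%:P \is a GRing.unit) = (c \is a GRing.unit).
Proof.
rewrite poly_unitE coefC eqxx size_polyC.
by have [->|] := eqVneq c 0; rewrite ?unitr0.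
Qed.

Definition primitive q := forall p, prime_elt p -> ~ divides p%:P q.

Lemma primitive_part q : q != 0 ->
  exists c q0, [/\ c != 0, q = c%:P * q0 & primitive q0].
Proof.
move=> q0; have [n] := ubnP (size (pfact ufdR (lead_coef q))).
(* Each constant prime taken out of [q] removes a prime factor from the leading coefficient. *)
elim: n q q0 => // n IH q q0 /ltnSE le_n.
have [[p [pp [r def_q]]]|np] :=
  EM (exists p, prime_elt p /\ divides p%:P q); last first.
  by exists 1, q; rewrite mul1r oner_neq0; split => // p pp pq; apply: np; exists p.
have r0 : r != 0 by apply: contraNneq q0 => r0; rewrite def_q r0 mul0r.
have p0 : p != 0 by case: pp.
have [|c [q1 [c0 def_r prim]]] := IH r r0; last first.
  exists (p * c), q1; split => //; first exact: mulf_neq0.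
  by rewrite def_q def_r mulrC polyCM mulrA.
apply: leq_trans le_n; rewrite def_q lead_coefM lead_coefC.
rewrite (perm_size (pfactM ufdR _ _)) ?lead_coef_eq0 // size_cat -addn1 leq_add2l.
by rewrite lt0n size_eq0; apply: pfact_nonunit => //; case: pp.
Qed.

(** Each prime of [c] divides [q * b] but not the primitive [q], so it divides [b] and cancels. This
    brings divisibility by [q] over the fraction field back to [R]. *)
Lemma primitive_cancel q c a b : primitive q -> c != 0 -> c%:P * a = q * b ->
  divides q a.
Proof.
move=> prim c0; move: c c0 a b; apply: (ufd_ind ufdR) => [u uu|p c pp c0 IH] a b.
  move=> e; exists (u^-1%:P * b).
  by rewrite -mulrA [b * q]mulrC -e mulrA -polyCM mulVr // mul1r.
move=> e; have [_ _ pP] := prime_polyC pp.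
have [|/(prim _ pp)//|[d def_b]] := pP q b.
  by rewrite -e polyCM mulrAC; apply/divides_mull/divides_refl.
apply: (IH a d); have p0 : p%:P != 0 by rewrite polyC_eq0; case: pp.
by apply: (mulIf p0); rewrite -[RHS]mulrA -def_b -e polyCM mulrAC.
Qed.

(** Each prime of [c] divides [a] or [b] and is cancelled there without changing the degree. So a
    factorization over the fraction field gives one over [R] with the same degrees. *)
Lemma scaled_factor c q a b : c != 0 -> q != 0 -> c%:P * q = a * b ->
  exists a' b', [/\ q = a' * b', size a' = size a & size b' = size b].
Proof.
move=> c0 q0; move: c c0 a b; apply: (ufd_ind ufdR) => [u uu|p c pp c0 IH] a b e.
  exists (u^-1%:P * a), b; split => //.
    by rewrite -mulrA -e mulrA -polyCM mulVr // mul1r.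
  by rewrite size_Cmul // invr_eq0; apply: contraTneq uu => ->; rewrite unitr0.
have p0 : p != 0 by case: pp.
have pC0 : p%:P != 0 :> {poly R} by rewrite polyC_eq0.
have [_ _ pP] := prime_polyC pp.
have [|[d def_a]|[d def_b]] := pP a b.
- by rewrite -e polyCM mulrAC; apply/divides_mull/divides_refl.
- have [|a' [b' [-> sa sb]]] := IH d b.
    by apply: (mulIf pC0); rewrite mulrAC [RHS]mulrAC -def_a -e polyCM mulrAC.
  by exists a', b'; rewrite sa sb def_a [d * _]mulrC size_Cmul.
- have [|a' [b' [-> sa sb]]] := IH a d.
    by apply: (mulIf pC0); rewrite -[RHS]mulrA -def_b -e polyCM mulrAC.
  by exists a', b'; rewrite sa sb def_b [d * _]mulrC size_Cmul.
Qed.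

(* Polynomial (pseudo-)divisibility [%|] over [R] is divisibility over the
   fraction field of [R], where the gcd is available. *)
Lemma primitive_irreducible_prime q : primitive q -> (1 < size q)%N ->
  (forall a b, q = a * b -> (size a <= 1)%N \/ (size b <= 1)%N) -> prime_elt q.
Proof.
move=> prim sq irr; have q0 : q != 0 by rewrite -size_poly_gt0 (ltn_trans _ sq).
split=> //; first by rewrite poly_unitE; case: eqP sq => // ->.
have real a : q %| a -> divides q a.
  move=> /Pdiv.Idomain.dvdpP[[c d] /= c0]; rewrite -mul_polyC [d * _]mulrC => e.
  exact: primitive_cancel e.
move=> a b [c def_ab]; have qab : q %| a * b by rewrite def_ab dvdp_mull.
(* The gcd of [q] and [a] gives a factorization of [q] over [R], in which one factor is constant.
   Either the gcd is associate to [q], which then divides [a], or [q] is coprime to [a] and divides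
   [b]. *)
have /Pdiv.Idomain.dvdpP[[k d] /= k0] := dvdp_gcdl q a.
rewrite -mul_polyC => /(scaled_factor k0 q0)[d' [g' [def_q sd sg]]].
have g0 : gcdp q a != 0 by rewrite gcdp_eq0 negb_and q0.
have d0 : d' != 0 by apply: contraNneq q0 => d0; rewrite def_q d0 mul0r.
have [le1|le1] := irr _ _ def_q; last first.
  right; apply: real; rewrite -(Gauss_dvdpr _ (q := a)) // coprimep_def.
  by rewrite -sg eqn_leq le1 sg size_poly_gt0.
left; apply: real; apply: dvdp_trans (dvdp_gcdr q a).
have qg: gcdp q a %= q.
  rewrite -(dvdp_size_eqp (dvdp_gcdl q a)) -sg def_q size_mul //; last first.
    by rewrite -size_poly_gt0 sg size_poly_gt0.
  have -> : size d' = 1%N by apply/eqP; rewrite eqn_leq le1 size_poly_gt0.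
  by rewrite add1n.
by rewrite -(eqp_dvdl _ qg).
Qed.

(** Induction on the degree: the content is factored in [R], and the primitive part is prime or
    splits into two factors of smaller degree. *)
Lemma ufd_poly : ufd {poly R}.
Proof.
have const (c : R) : c != 0 -> prime_fact c%:P.
  move: c; apply: (ufd_ind ufdR) => [u uu|p c pp c0 IH].
    exists [::] => //; rewrite big_nil; exists u%:P; rewrite ?unit_polyC ?mulr1 //.
  by rewrite polyCM; apply: prime_factM => //; apply/prime_fact1/prime_polyC.
move=> q; have [n] := ubnP (size q); elim: n q => // n IH q /ltnSE le_n q0.
have [sq|sq] := leqP (size q) 1.
  by move: q0; rewrite [q]size1_polyC // polyC_eq0; apply: const.
have [c [r [c0 def_q prim]]] := primitive_part q0.
have sr : size r = size q by rewrite def_q size_Cmul.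
rewrite def_q; apply: prime_factM; first exact: const.
have [[a [b [def_r sa sb]]]|irr] :=
    EM (exists a b, [/\ r = a * b, (1 < size a)%N & (1 < size b)%N]); last first.
  apply/prime_fact1/primitive_irreducible_prime; rewrite ?sr // => a b def_r.
  have [|sa] := leqP (size a) 1; first by left.
  have [|sb] := leqP (size b) 1; first by right.
  by case: irr; exists a, b.
have a0 : a != 0 by rewrite -size_poly_gt0 (ltn_trans _ sa).
have b0 : b != 0 by rewrite -size_poly_gt0 (ltn_trans _ sb).
have := size_mul a0 b0; rewrite -def_r sr => sab.
rewrite def_r; apply: prime_factM; apply: IH => //; apply: leq_trans le_n; rewrite sab.
  by rewrite -(ltn_predK sb) addnS /= -addn1 leq_add2l -ltnS (ltn_predK sb).
by rewrite -(ltn_predK sa) addSn /= -add1n leq_add2r -ltnS (ltn_predK sa).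
Qed.

End UFDPoly.

(** * Unique factorization of integers *)

Lemma unit_int (z : int) : (z \is a GRing.unit) = (`|z| == 1)%N.
Proof. by rewrite qualifE /=; case: z => [[|[|n]]|[|n]]. Qed.

Lemma prime_int (p : nat) : prime p -> prime_elt (p%:Z).
Proof.
have dvdE (a : int) : (divides p%:Z a) <-> (p %| `|a|)%N.
  rewrite -[p]/(`|p%:Z|%N) -dvdzE; split; first by move=> [c ->]; rewrite dvdz_mull.
  by move=> /dvdzP.
move=> pp; split.
- by rewrite eqz_nat -lt0n prime_gt0.
- by rewrite unit_int /=; case: p pp {dvdE} => [|[|]].
- move=> a b /dvdE; rewrite abszM Euclid_dvdM // => /orP[]/dvdE; tauto.
Qed.

Lemma ufd_int : ufd int.
Proof.
move=> a; have [n] := ubnP `|a|%N; elim: n a => // n IH a /ltnSE le_n a0.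
have [a1|a1] := eqVneq `|a|%N 1%N.
  exists [::] => //; rewrite big_nil; exists a; rewrite ?mulr1 //.
  by rewrite unit_int a1.
have pp : prime (pdiv `|a|) by rewrite pdiv_prime // ltn_neqAle eq_sym a1 absz_gt0.
have /dvdzP[b def_a] : ((pdiv `|a|)%:Z %| a)%Z by rewrite dvdzE pdiv_dvd.
have b0 : b != 0 by apply: contraNneq a0 => b0; rewrite def_a b0 mul0r.
have [|//|s ps sb] := IH b.
  apply: leq_trans le_n; rewrite [in X in (_ < X)%N]def_a abszM ltn_Pmulr //.
    exact: prime_gt1.
  by rewrite absz_gt0.
rewrite def_a; apply: prime_factM; last exact/prime_fact1/prime_int.
by exists s.
Qed.

(** * A pairing on factorizations *)

Section Intersection.
Variable S : idomainType.
Hypothesis ufdS : ufd S.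
Implicit Types a b c : S.

(* [sum_p v_p(a) v_p(b)], where [v_p] is the multiplicity of the prime [p]. *)
Definition inter a b : nat :=
  (\sum_(p <- pfact ufdS a) count_mem p (pfact ufdS b))%N.

Lemma interML a b c : a != 0 -> b != 0 ->
  inter (a * b) c = (inter a c + inter b c)%N.
Proof. by move=> a0 b0; rewrite /inter (perm_big _ (pfactM ufdS a0 b0)) big_cat. Qed.

Lemma inter_assoc a b c : a != 0 -> assoc a b -> inter a c = inter b c.
Proof.
move=> a0 ab; have b0 : b != 0.
  case: ab => u uu ->; rewrite mulf_neq0 //.
  by apply: contraTneq uu => ->; rewrite unitr0.
apply: perm_big; apply: nprime_fact_uniq; [exact: pfact_nprime..|].
apply: assoc_trans (pfact_prod ufdS a0) _; apply: assoc_trans ab _.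
exact/assoc_sym/pfact_prod.
Qed.

Lemma inter_unitl u c : u \is a GRing.unit -> inter u c = 0%N.
Proof. by move=> uu; rewrite /inter (pfact_unit _ uu) big_nil. Qed.

Lemma inter_diag_gt0 a : a != 0 -> a \isn't a GRing.unit -> (0 < inter a a)%N.
Proof.
move=> a0 /(pfact_nonunit ufdS a0); rewrite /inter.
case: (pfact ufdS a) => // p s _.
by rewrite big_cons /= eqxx.
Qed.

Lemma interC a b : inter a b = inter b a.
Proof.
rewrite /inter; under eq_bigr do rewrite -sum1_count big_mkcond.
rewrite exchange_big; apply: eq_bigr => p _.
rewrite -sum1_count [RHS]big_mkcond; apply: eq_bigr => q _ /=.
by rewrite eq_sym.
Qed.

(** Counting pairs of equal factors allows a termwise comparison with [inter_morph_self]. *)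
Lemma inter_self a : inter a a =
  (\sum_(p <- pfact ufdS a) \sum_(q <- pfact ufdS a) (q == p))%N.
Proof.
rewrite /inter; apply: eq_bigr => p _; rewrite -sum1_count big_mkcond.
by apply: eq_bigr => q _ /=; case: eqP.
Qed.

End Intersection.

Lemma sum_leq_eq (I : eqType) (s : seq I) (f g : I -> nat) :
  {in s, forall i, f i <= g i}%N ->
  (\sum_(i <- s) f i <= \sum_(i <- s) g i)%N *
  ((\sum_(i <- s) g i <= \sum_(i <- s) f i)%N -> {in s, f =1 g}).
Proof.
elim: s => [|i s IH] le; first by rewrite !big_nil; split=> // _ i.
have [|le_s eq_s] := IH; first by move=> j js; apply: le; rewrite in_cons js orbT.
have le_i := le i (mem_head _ _); rewrite !big_cons; split; first exact: leq_add.
move=> ge j; have fi : f i = g i.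
  apply/eqP; rewrite eqn_leq le_i -(leq_add2r (\sum_(j <- s) g j)).
  by rewrite (leq_trans ge) // leq_add2l.
rewrite in_cons => /predU1P[->//|]; apply: eq_s.
by move: ge; rewrite fi leq_add2l.
Qed.

(** * Ring morphisms and multiplicities of primes *)

Section Morphism.
Variables (R S : idomainType) (ufdR : ufd R) (ufdS : ufd S).
Variables (s : {rmorphism R -> S}) (F : R).
Hypothesis sF0 : s F != 0.
Hypothesis s_unit : forall a, divides a F -> s a \is a GRing.unit -> a \is a GRing.unit.

Let F0 : F != 0.
Proof. by apply: contraNneq sF0 => ->; rewrite rmorph0. Qed.

Lemma morph_divisor_neq0 a : divides a F -> s a != 0.
Proof.
move=> [c def_F]; apply: contraNneq sF0 => sa.
by rewrite def_F rmorphM sa mulr0.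
Qed.

Lemma inter_morph a c : s a != 0 ->
  inter ufdS (s a) c = (\sum_(p <- pfact ufdR a) inter ufdS (s p) c)%N.
Proof.
move=> sa; have a0 : a != 0 by apply: contraNneq sa => ->; rewrite rmorph0.
have [u uu def_a] := pfact_prod ufdR a0.
have su0 : s u != 0 by apply: contraNneq sa => su; rewrite def_a rmorphM su mul0r.
have : s (\prod_(p <- pfact ufdR a) p) != 0.
  by apply: contraNneq sa => sp; rewrite def_a rmorphM sp mulr0.
move=> sp0; rewrite {1}def_a rmorphM interML // inter_unitl ?rmorph_unit // add0n.
elim: (pfact ufdR a) sp0 {def_a} => [|p t IH].
  by rewrite !big_nil rmorph1 inter_unitl ?unitr1.
by rewrite !big_cons rmorphM mulf_eq0 negb_or => /andP[p0 t0]; rewrite interML // IH.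
Qed.

Lemma pfactF_morph p : p \in pfact ufdR F ->
  [/\ s p != 0, s p \isn't a GRing.unit & p != 0].
Proof.
move=> pF; have pdF := pfact_divides F0 pF; have [[p0 pu _] _] := pfact_nprime pF.
split=> //; first exact: morph_divisor_neq0.
by apply: contra pu; apply: s_unit.
Qed.

Lemma inter_morph_self : inter ufdS (s F) (s F) =
  (\sum_(p <- pfact ufdR F) \sum_(q <- pfact ufdR F) inter ufdS (s p) (s q))%N.
Proof.
rewrite inter_morph //; apply: eq_bigr => p _; rewrite interC inter_morph //.
by apply: eq_bigr => q _; rewrite interC.
Qed.

Let termwise p q : p \in pfact ufdR F -> q \in pfact ufdR F ->
  ((q == p) <= inter ufdS (s p) (s q))%N.
Proof.
by move=> /pfactF_morph[sp spu _] _; case: eqP => // ->; apply: inter_diag_gt0.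
Qed.

(** Both sides are sums over pairs of prime factors of [F]. A pair of equal factors contributes 1 on
    the left and at least 1 on the right, since its image is a nonunit. *)
Lemma inter_self_morph : (inter ufdR F F <= inter ufdS (s F) (s F))%N.
Proof.
rewrite inter_self inter_morph_self; apply: (sum_leq_eq _).1 => p pF.
by apply: (sum_leq_eq _).1 => q; apply: termwise.
Qed.

Hypothesis inter_eq : inter ufdR F F = inter ufdS (s F) (s F).

(** Equal sums force equality in every term: primes of [F] have prime images, and distinct ones have
    images without a common prime. *)
Lemma inter_morph_prime p q : p \in pfact ufdR F -> q \in pfact ufdR F ->
  inter ufdS (s p) (s q) = (q == p).
Proof.
move: inter_eq; rewrite inter_self inter_morph_self => e pF qF.
have le1 p' : p' \in pfact ufdR F -> {in pfact ufdR F, forall q',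
    ((q' == p') <= inter ufdS (s p') (s q'))%N} by move=> pF' q'; apply: termwise.
have le2 p' : p' \in pfact ufdR F -> _ := fun pF => (sum_leq_eq (le1 p' pF)).1.
apply/esym; apply: (sum_leq_eq (le1 p pF)).2 => //.
by rewrite leq_eqVlt ((sum_leq_eq le2).2 _ p pF) ?eqxx // e.
Qed.

(** The multiplicity of a prime [p] of [F] in a divisor [c] can be read off from the image of [c],
    as its pairing with [s p]. *)
Lemma assoc_morph_inj a b : divides a F -> divides b F ->
  assoc (s a) (s b) -> assoc a b.
Proof.
have sub c p : divides c F -> p \in pfact ufdR c -> p \in pfact ufdR F.
  move=> [d def_F] pc; have : d * c != 0 by rewrite -def_F.
  rewrite mulf_eq0 negb_or => /andP[d0 c0].
  by rewrite def_F (perm_mem (pfactM ufdR d0 c0)) mem_cat pc orbT.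
have mult c p : divides c F -> p \in pfact ufdR F ->
    inter ufdS (s c) (s p) = count_mem p (pfact ufdR c).
  move=> cF pF; rewrite inter_morph ?morph_divisor_neq0 // -sum1_count.
  rewrite [RHS]big_mkcond [LHS]big_seq [RHS]big_seq; apply: eq_bigr => q qc /=.
  by rewrite (inter_morph_prime (sub c q cF qc) pF) eq_sym; case: eqP.
move=> aF bF ab; have [sa0 sb0] := (morph_divisor_neq0 aF, morph_divisor_neq0 bF).
have neq0 c : s c != 0 -> c != 0 by apply: contraNneq => ->; rewrite rmorph0.
apply: (pfact_assoc (neq0 _ sa0) (neq0 _ sb0)); apply/allP => p.
rewrite mem_cat => pab /=.
have pF : p \in pfact ufdR F by case/orP: pab; apply: sub.
by rewrite -!mult // (inter_assoc _ _ sa0 ab).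
Qed.

End Morphism.

(** * Polynomials in n variables *)

(* [mpol n] is Z[x_1, ..., x_n] as a tower in which the outermost variable is
   [x_1], so that exponent sequences are read from their head. *)
Fixpoint mpol (n : nat) : idomainType :=
  if n is n'.+1 then {poly mpol n'} else int.

Lemma ufd_mpol n : ufd (mpol n).
Proof. by elim: n => [|n IH]; [apply: ufd_int | apply: ufd_poly]. Qed.

(* Sets [x_(k+1)] to 0 and renumbers the later variables; meaningful for
   [k <= n]. *)
Fixpoint sub0 (n k : nat) : {rmorphism mpol n.+1 -> mpol n} :=
  match n, k return {rmorphism mpol n.+1 -> mpol n} with
  | n'.+1, k'.+1 => map_poly (sub0 n' k')
  | n', _ => coefp 0
  end.

(* [homog] sends [x_i] to [x_i t], so [size (homog n p)] is one more than the
   total degree of [p <> 0], and total degree is additive on products. *)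
Definition homX n : {poly {poly mpol n}} := ('X)%:P * 'X.

Fixpoint homog (n : nat) : {rmorphism mpol n -> {poly mpol n}} :=
  if n is n'.+1 return {rmorphism mpol n -> {poly mpol n}} then
    horner_eval (homX n') \o map_poly (map_poly polyC \o homog n')
  else polyC.

Fixpoint mcoef n : mpol n -> monom -> int :=
  if n is n'.+1 return mpol n -> monom -> int then
    fun p m => mcoef (p`_(head 0%N m)) (behead m)
  else fun c _ => c.

(** [D] caps each exponent separately, which loses no term in the first [n] variables when [f] has
    degree at most [D]. *)
Fixpoint trunc (D n : nat) (f : series) : mpol n :=
  if n is n'.+1 then \poly_(i < D.+1) trunc D n' (fun m => f (i :: m))
  else f [::].

(** * Homogenization and total degree *)

Lemma homog_C n (c : mpol n) : homog n.+1 c%:P = map_poly polyC (homog n c).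
Proof. by rewrite /= map_polyC /= /horner_eval hornerC. Qed.

Lemma homog_X n : homog n.+1 'X = homX n.
Proof. by rewrite /= map_polyX /horner_eval hornerX. Qed.

Lemma homog_XC n (q : {poly mpol n}) c :
  homog n.+1 (q * 'X + c%:P) = homog n.+1 q * homX n + map_poly polyC (homog n c).
Proof. by rewrite rmorphD rmorphM homog_X homog_C. Qed.

Lemma homog1 n (p : mpol n) : (homog n p).[1] = p.
Proof.
elim: n p => [|n IH] p; first by rewrite /= hornerC.
elim/poly_ind: p => [|q c IHq]; first by rewrite rmorph0 horner0.
rewrite homog_XC hornerD hornerM IHq /homX hornerM hornerC hornerX mulr1.
by rewrite -[X in (map_poly _ _).[X]](polyC1 (mpol n)) horner_map /= IH.
Qed.

(** At t = 0 only the constant term survives. With [homog1], a polynomial whose homogenization is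
    constant in t is an integer. *)
Lemma homog0 n (p : mpol n) : exists z : int, (homog n p).[0] = z%:~R.
Proof.
elim: n p => [|n IH] p; first by exists p; rewrite /= hornerC intz.
elim/poly_ind: p => [|q c _]; first by exists 0; rewrite rmorph0 horner0.
have [z Hz] := IH c; exists z.
rewrite homog_XC hornerD hornerM /homX hornerM hornerX !mulr0 add0r.
by rewrite -[X in (map_poly _ _).[X]](polyC0 (mpol n)) horner_map /= Hz rmorph_int.
Qed.

Lemma sub0_XC n k (q : {poly mpol n.+1}) c :
  sub0 n.+1 k.+1 (q * 'X + c%:P) = sub0 n.+1 k.+1 q * 'X + (sub0 n k c)%:P.
Proof. by rewrite rmorphD rmorphM /= map_polyX map_polyC. Qed.

Lemma coefp0_XC (R : nzRingType) (q : {poly R}) c : coefp 0 (q * 'X + c%:P) = c.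
Proof. by rewrite /= coefD coefMX coefC add0r. Qed.

Lemma map_coefp0_polyC (R : comNzRingType) (p : {poly R}) :
  map_poly (coefp 0) (map_poly polyC p) = p.
Proof. by apply/polyP => i; rewrite coef_map coef_map /= coefC. Qed.

Lemma map_map_polyC (R S : comNzRingType) (f : {rmorphism R -> S}) (p : {poly R}) :
  map_poly (map_poly f) (map_poly polyC p) = map_poly polyC (map_poly f p).
Proof. by apply/polyP => i; rewrite !coef_map /= map_polyC. Qed.

Lemma map_homX n (f : {rmorphism {poly mpol n} -> mpol n}) : f 'X = 0 ->
  map_poly f (homX n) = 0.
Proof. by move=> f0; rewrite /homX rmorphM /= map_polyC /= f0 mul0r. Qed.

(** Setting a variable to 0 commutes with scaling all variables by t, so it cannot raise the total
    degree. *)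
Lemma homog_sub0 n k (p : mpol n.+1) :
  homog n (sub0 n k p) = map_poly (sub0 n k) (homog n.+1 p).
Proof.
have base (m : nat) (q : mpol m.+1) :
    homog m (coefp 0 q) = map_poly (coefp 0) (homog m.+1 q).
  elim/poly_ind: q => [|q c _]; first by rewrite !rmorph0.
  have X0 : map_poly (coefp 0) (homX m) = 0 by apply: map_homX; rewrite /= coefX.
  rewrite coefp0_XC homog_XC rmorphD rmorphM /= X0 mulr0 add0r.
  exact/esym/map_coefp0_polyC.
elim: n k p => [|n IH] [|k] p; try exact: base.
elim/poly_ind: p => [|q c IHq]; first by rewrite !rmorph0.
rewrite sub0_XC 2!homog_XC IHq IH [RHS]rmorphD [in RHS]rmorphM; congr (_ * _ + _).
  by rewrite /homX rmorphM /= map_polyC map_polyX /= map_polyX.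
exact/esym/map_map_polyC.
Qed.

(** Both sides set x_(k+1) and x_(k+2) to 0. *)
Lemma sub0_sub0 n k (p : mpol n.+2) : (k <= n)%N ->
  sub0 n k (sub0 n.+1 k p) = sub0 n k (sub0 n.+1 k.+1 p).
Proof.
elim: n k p => [|n IH] [|k] p // le_kn; try exact/esym/coef_map.
apply/(@polyP (mpol n)) => i; rewrite !coef_map.
exact: IH.
Qed.

Lemma size_homog_sub0 n k (p : mpol n.+1) :
  (size (homog n (sub0 n k p)) <= size (homog n.+1 p))%N.
Proof. by rewrite homog_sub0 size_poly. Qed.

Lemma intr_mpol_inj n : injective (fun z : int => z%:~R : mpol n).
Proof.
elim: n => [|n IH] x y /=; first by rewrite !intz.
by rewrite -!(rmorph_int polyC) => /polyC_inj/IH.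
Qed.

Lemma unit_mpol n (u : mpol n) : u \is a GRing.unit ->
  exists2 z : int, z \is a GRing.unit & u = z%:~R.
Proof.
elim: n u => [|n IH] u; first by exists u; rewrite ?intz.
rewrite poly_unitE => /andP[/eqP su /IH[z zu u0]]; exists z => //.
by rewrite [u]size1_polyC ?su // u0 rmorph_int.
Qed.

(* If the total degree of [F] is preserved, so is that of each divisor: a
   divisor with unit image is then an integer constant. *)
Lemma sub0_unit n k (F a : mpol n.+1) :
  sub0 n k F != 0 -> size (homog n.+1 F) = size (homog n (sub0 n k F)) ->
  divides a F -> sub0 n k a \is a GRing.unit -> a \is a GRing.unit.
Proof.
move=> sF0 eq_size [c def_F]; set s := sub0 n k => sau.
have hsize m (p q : mpol m) : p * q != 0 ->
    (size (homog m (p * q))).+1 = (size (homog m p) + size (homog m q))%N.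
  have h0 r : r != 0 -> homog m r != 0.
    by apply: contra_neq => hr; rewrite -[r]homog1 hr horner0.
  rewrite mulf_eq0 negb_or => /andP[p0 q0].
  rewrite rmorphM size_mul ?h0 // prednK // addn_gt0 lt0n size_poly_eq0.
  by rewrite h0.
have F0 : F != 0 by apply: contraNneq sF0 => ->; rewrite rmorph0.
have : size (homog n.+1 a) = 1%N.
  have [z zu def_sa] := unit_mpol sau.
  have s1 : size (homog n (s a)) = 1%N.
    rewrite def_sa rmorph_int -(rmorph_int polyC) size_polyC -def_sa.
    by have -> : s a != 0 by apply: contraTneq sau => ->; rewrite unitr0.
  apply/eqP; rewrite eqn_leq -{2}s1 size_homog_sub0 andbT.
  (* The degrees of [c] and [a] have the same sum as those of their images. As [s] does not raise
     the degree of [c], that of [a] is at most that of [s a], which is 0. *)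
  have sF : s F = s c * s a by rewrite def_F rmorphM.
  have := hsize _ (s c) (s a); rewrite -sF => /(_ sF0).
  rewrite -eq_size def_F hsize -?def_F // s1 => e.
  by rewrite -(leq_add2l (size (homog n.+1 c))) e leq_add2r size_homog_sub0.
move=> /eqP/size_poly1P[c0 _ hc]; have [z] := homog0 a.
have := homog1 a; rewrite hc !hornerC => -> def_a.
have [w wu] := unit_mpol sau; rewrite def_a rmorph_int => /intr_mpol_inj ->.
exact: rmorph_unit.
Qed.

(** The two divisors are associate, and the unit relating them is an integer. As [sub0] fixes
    integers, this unit is 1. *)
Lemma sub0_divisor_inj n k (F a b : mpol n.+1) :
  sub0 n k F != 0 -> size (homog n.+1 F) = size (homog n (sub0 n k F)) ->
  inter (@ufd_mpol n.+1) F F = inter (@ufd_mpol n) (sub0 n k F) (sub0 n k F) ->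
  divides a F -> divides b F -> sub0 n k a = sub0 n k b -> a = b.
Proof.
move=> sF0 eq_size eq_inter aF bF sab.
have ab : assoc a b.
  apply: (assoc_morph_inj (ufdR := @ufd_mpol n.+1) (ufdS := @ufd_mpol n) sF0)
    aF bF _ => //.
    by move=> c; apply: sub0_unit.
  by rewrite sab; apply: assoc_refl.
have [u uu def_b] := ab; have [z zu def_u] := unit_mpol uu.
move: sab; rewrite def_b rmorphM -{1}[sub0 n k a]mul1r.
move=> /(mulIf (morph_divisor_neq0 sF0 aF)).
rewrite def_u rmorph_int -[1]/(1%:~R) => /intr_mpol_inj <-.
by rewrite mul1r.
Qed.

(** * Coefficients of polynomials and truncations *)

Fixpoint ins0 (k : nat) (m : monom) : monom :=
  if k is k'.+1 then head 0%N m :: ins0 k' (behead m) else 0%N :: m.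

Lemma mcoef_sub0 n k (p : mpol n.+1) m : (k <= n)%N ->
  mcoef (sub0 n k p) m = mcoef p (ins0 k m).
Proof.
elim: n k p m => [|n IH] [|k] p m //= le_kn.
by rewrite coef_map; apply: IH.
Qed.

Lemma mcoef0 n m : mcoef (0 : mpol n) m = 0.
Proof. by elim: n m => [|n IH] m //=; rewrite coef0. Qed.

Lemma mcoefD n (p q : mpol n) m : mcoef (p + q) m = mcoef p m + mcoef q m.
Proof. by elim: n p q m => [|n IH] p q m //=; rewrite coefD. Qed.

Lemma mcoef_sum n (I : Type) (r : seq I) (F : I -> mpol n) m :
  mcoef (\sum_(i <- r) F i) m = \sum_(i <- r) mcoef (F i) m.
Proof.
by apply: (big_morph (fun p : mpol n => mcoef p m)) => [p q|]; rewrite ?mcoef0 ?mcoefD.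
Qed.

Lemma mcoef1 n m : size m = n -> mcoef (1 : mpol n) m = oneK m.
Proof.
elim: n m => [|n IH] [|a m] //= [sm].
rewrite coef1 /oneK /mdeg /= addn_eq0; case: eqP => _ /=; last exact: mcoef0.
exact: IH.
Qed.

Lemma mcoef_inj n (p q : mpol n) :
  (forall m, size m = n -> mcoef p m = mcoef q m) -> p = q.
Proof.
elim: n p q => [|n IH] p q pq; first exact: (pq [::]).
by apply/(@polyP (mpol n)) => i; apply: IH => m sm; apply: (pq (i :: m)); rewrite /= sm.
Qed.

Lemma divs_size m d : d \in divs m -> size d = size m /\ size (msub m d) = size m.
Proof.
elim: m d => [|a m IH] d; first by rewrite inE => /eqP->.
move=> /allpairsPdep[i [e [_ /IH[se sm] ->]]]; split; first by rewrite /= se.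
by rewrite /= -[in RHS]sm.
Qed.

Lemma mcoefM n (p q : mpol n) m : size m = n ->
  mcoef (p * q) m = \sum_(d <- divs m) mcoef p d * mcoef q (msub m d).
Proof.
elim: n p q m => [|n IH] p q [|a m] // sm; first by rewrite big_seq1.
rewrite -[divs _]/([seq i :: d | i <- iota 0 a.+1, d <- divs m]).
rewrite big_allpairs_dep [LHS]/= coefM.
rewrite -(big_mkord xpredT (fun i => p`_i * q`_(a - i))).
rewrite mcoef_sum /index_iota subn0; apply: eq_bigr => i _.
by rewrite IH //; case: sm.
Qed.

Lemma mcoef_trunc D n f m : (forall m, (D < mdeg m)%N -> f m = 0) -> size m = n ->
  mcoef (trunc D n f) m = f m.
Proof.
elim: n f m => [|n IH] f [|a m] //= fD [sm].
rewrite coef_poly; case: ltnP => aD.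
  rewrite IH // => e De; apply: fD; apply: leq_trans De _; exact: leq_addl.
by rewrite mcoef0 fD //; apply: leq_trans aD _; apply: leq_addr.
Qed.

Lemma homog_sum n (p : mpol n.+1) : homog n.+1 p =
  \sum_(i < size (p : {poly mpol n})) map_poly polyC (homog n p`_i) * homX n ^+ i.
Proof.
have {1}-> : p = \sum_(i < size (p : {poly mpol n})) (p`_i)%:P * 'X^i :> {poly mpol n}.
  by rewrite -{1}[p]coefK poly_def; apply: eq_bigr => i _; rewrite mul_polyC.
rewrite rmorph_sum; apply: eq_bigr => i _.
by rewrite rmorphM rmorphXn -homog_C -homog_X.
Qed.

(** The coefficient of x_1^i has total degree at most D - i, and its factor x_1^i adds i; for i > D
    it vanishes. *)
Lemma size_homog D n (p : mpol n) :
  (forall m, size m = n -> (D < mdeg m)%N -> mcoef p m = 0) ->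
  (size (homog n p) <= D.+1)%N.
Proof.
elim: n D p => [|n IH] D p pD; first by rewrite /= size_polyC; case: eqP.
rewrite homog_sum; apply: leq_trans (size_sum _ _ _) _; apply/bigmax_leqP => i _.
have pi m : size m = n -> mcoef (p`_i) m = mcoef p (nat_of_ord i :: m) by [].
have [iD|Di] := leqP i D; last first.
  have -> : p`_i = 0.
    apply: mcoef_inj => m sm; rewrite pi // mcoef0; apply: pD; rewrite /= ?sm //.
    by apply: leq_trans Di _; apply: leq_addr.
  by rewrite !rmorph0 mul0r size_poly0.
have le1 : (size (map_poly polyC (homog n (p`_i)%R)) <= (D - i).+1)%N.
  rewrite size_map_polyC; apply: IH => m sm Dm; rewrite pi //.
  apply: pD; rewrite /= ?sm //.
  by rewrite /mdeg /= -ltn_subLR.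
rewrite /homX exprMn -rmorphXn mulrA; apply: leq_trans (size_polyMleq _ _) _.
rewrite size_polyXn addnS /=.
apply: (@leq_trans ((D - i).+1 + i)); last by rewrite addSn subnK.
rewrite leq_add2r mulrC; apply: leq_trans (size_polyMleq _ _) _.
apply: leq_trans le1; rewrite -subn1 leq_subLR leq_add2r size_polyC; exact: leq_b1.
Qed.

(** * Quasi-symmetric series *)

(** After a strict drop at [n] the argument restarts from [n.+1] with a smaller value. *)
Lemma noninc_stable (u : nat -> nat) N : (forall n, (N <= n)%N -> (u n.+1 <= u n)%N) ->
  exists2 N', (N <= N')%N & forall n, (N' <= n)%N -> u n.+1 = u n.
Proof.
have [k] := ubnP (u N); elim: k N => // k IH N /ltnSE le_k noninc.
have [stable|] := EM (forall n, (N <= n)%N -> u n.+1 = u n); first by exists N.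
move=> /existsNP[n /not_implyP[Nn /eqP neq]].
have le_n i : (N <= i)%N -> (u i <= u N)%N.
  move=> /subnK <-; elim: (i - N)%N => // j IHj.
  by apply: leq_trans IHj; apply: noninc; apply: leq_addl.
have [|i ni|N' le_N' stable] := IH n.+1.
- by apply: leq_trans le_k; apply: leq_trans (le_n n Nn); rewrite ltn_neqAle neq noninc.
- by apply: noninc; apply: leq_trans Nn (ltnW ni).
- by exists N' => //; apply: leq_trans le_N'; apply: leqW.
Qed.

Lemma nondec_bounded_stable (u : nat -> nat) N B :
  (forall n, u n <= B)%N -> (forall n, (N <= n)%N -> (u n <= u n.+1)%N) ->
  exists2 N', (N <= N')%N & forall n, (N' <= n)%N -> u n.+1 = u n.
Proof.
move=> uB nondec; have [n Nn|N' NN' stable] := @noninc_stable (fun n => B - u n)%N N.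
  by rewrite leq_sub2l ?nondec.
exists N' => // n /stable e.
by rewrite -[LHS](subKn (uB _)) e subKn.
Qed.

Definition bounded D (f : series) := forall m, (D < mdeg m)%N -> f m = 0.

Definition padded (f : series) := forall m, f (rcons m 0%N) = f m.

Lemma padded_nseq f m k : padded f -> f (m ++ nseq k 0%N) = f m.
Proof.
move=> fP; elim: k => [|k IH]; first by rewrite cats0.
by rewrite -addn1 nseqD catA cats1 fP.
Qed.

Lemma ins0_cat s t : ins0 (size s) (s ++ t) = s ++ 0%N :: t.
Proof. by elim: s => //= a s ->. Qed.

Lemma filter_ins0 k m : (k <= size m)%N ->
  [seq a <- ins0 k m | a != 0%N] = [seq a <- m | a != 0%N].
Proof. by elim: k m => [|k IH] [|a m] //= km; rewrite IH. Qed.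

Lemma size_ins0 k m : (k <= size m)%N -> size (ins0 k m) = (size m).+1.
Proof. by elim: k m => [|k IH] [|a m] //= km; rewrite IH. Qed.

(** Padding with [N] trailing zeros makes any sequence long enough for the hypothesis. Zeros can
    then be deleted one by one, leaving the sequence of nonzero exponents. *)
Lemma QSym_ins0 f N : inK f ->
  (forall m k, (N <= size m)%N -> (k <= size m)%N -> f (ins0 k m) = f m) -> QSym f.
Proof.
move=> fK ins; split=> //; have [fP _] := fK.
have del s t : f (s ++ 0%N :: t) = f (s ++ t).
  rewrite -(padded_nseq (s ++ t) N fP) -(padded_nseq (s ++ 0%N :: t) N fP).
  rewrite -!catA cat_cons -ins0_cat ins //; last by rewrite size_cat leq_addr.
  by rewrite !size_cat size_nseq addnA leq_addl.
have filt m : f m = f [seq a <- m | a != 0%N].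
  rewrite -[RHS]/(f ([::] ++ _)) -[m in LHS]/([::] ++ m).
  elim: m [::] => [|a m IH] s //=.
  have [->|_] := eqVneq a 0%N; first by rewrite del IH.
  by rewrite -!cat_rcons IH.
by move=> m1 m2 e; rewrite filt e -filt.
Qed.

Lemma sub0_trunc D n k f : bounded D f -> (k <= n)%N ->
  (forall m, size m = n -> f (ins0 k m) = f m) ->
  sub0 n k (trunc D n.+1 f) = trunc D n f.
Proof.
move=> fD kn ins; apply: mcoef_inj => m sm.
by rewrite mcoef_sub0 // !mcoef_trunc ?size_ins0 ?sm // ins.
Qed.

Lemma sub0_trunc_last D n f : bounded D f -> padded f ->
  sub0 n n (trunc D n.+1 f) = trunc D n f.
Proof.
move=> fD fP; apply: sub0_trunc => // m sm.
by rewrite -[m in LHS]cats0 -{1}sm ins0_cat cats1 fP.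
Qed.

(** * Truncation of a factorization *)

Lemma trunc_prod D n fs :
  (forall i, (i < size fs)%N -> bounded D (nth zeroK fs i)) ->
  forall m, size m = n ->
  mcoef (\prod_(g <- fs) trunc D n g) m = prodK fs m.
Proof.
elim: fs => [|g fs IH] fsD m sm; first by rewrite big_nil mcoef1.
rewrite big_cons mcoefM //= /mulK big_seq [RHS]big_seq; apply: eq_bigr => d dm.
have [sd sr] := divs_size dm.
rewrite (mcoef_trunc (fsD 0%N _)) ?sd // IH ?sr //.
by move=> i; apply: (fsD i.+1).
Qed.

(** Stated for all larger bounds, so that one bound can serve both the factors and their product. *)
Lemma common_bound (fs : seq series) :
  (forall i, (i < size fs)%N -> inK (nth zeroK fs i)) ->
  exists D, forall D', (D <= D')%N ->
    forall i, (i < size fs)%N -> bounded D' (nth zeroK fs i).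
Proof.
elim: fs => [|g fs IH] fsK; first by exists 0%N.
have [D fsD] := IH (fun i => fsK i.+1); have [_ [E gE]] := fsK 0%N isT.
exists (maxn D E) => D'; rewrite geq_max => /andP[DD' ED'] [_ m D'm|i].
  by apply: gE; apply: leq_ltn_trans D'm.
exact: fsD.
Qed.

Lemma prod_trunc_neq0 D (fs : seq series) :
  (forall i, (i < size fs)%N -> [/\ padded (nth zeroK fs i),
     ~ eqK (nth zeroK fs i) zeroK & bounded D (nth zeroK fs i)]) ->
  exists N, forall n, (N <= n)%N -> \prod_(g <- fs) trunc D n g != 0.
Proof.
elim: fs => [|g fs IH] fsK; first by exists 0%N => n _; rewrite big_nil oner_neq0.
have [N fsN] := IH (fun i => fsK i.+1).
have [gP /existsNP[m /eqP gm] gD] := fsK 0%N isT.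
exists (maxn N (size m)) => n; rewrite geq_max => /andP[Nn mn].
rewrite big_cons mulf_neq0 ?fsN //; apply: contraNneq gm => g0.
rewrite -(padded_nseq m (n - size m) gP) -(@mcoef_trunc D n) //.
  by rewrite g0 mcoef0.
by rewrite size_cat size_nseq subnKC.
Qed.

Lemma divides_prod (R : idomainType) (T : Type) (x0 : T) (phi : T -> R) s i :
  (i < size s)%N -> divides (phi (nth x0 s i)) (\prod_(x <- s) phi x).
Proof.
elim: s i => // x s IH [_|i /IH]; rewrite big_cons.
  exact/divides_mulr/divides_refl.
exact: divides_mull.
Qed.

Theorem theorem8p1 (f : series) (fs : seq series) :
  QSym f ->
  (forall i, (i < size fs)%N -> irreducibleK (nth zeroK fs i)) ->
  eqK f (prodK fs) ->
  forall i, (i < size fs)%N -> QSym (nth zeroK fs i).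
Proof.
move=> [[fP [Df fDf]] fQ] irr f_prod i i_fs.
have fsK j : (j < size fs)%N -> inK (nth zeroK fs j) by move=> /irr[].
have [Ds fsDs] := common_bound fsK; pose D := maxn Df Ds.
have fD : bounded D f.
  by move=> m Dm; apply: fDf; apply: leq_ltn_trans Dm; apply: leq_maxl.
have {fsDs} fsD := fsDs D (leq_maxr _ _).
set g := nth zeroK fs i; have gK : inK g := fsK i i_fs.
have [gP _] := gK; have gD : bounded D g := fsD i i_fs.
pose F n := trunc D n f; pose G n := trunc D n g.
have F_prod n : F n = \prod_(h <- fs) trunc D n h.
  by apply: mcoef_inj => m sm; rewrite trunc_prod // mcoef_trunc.
have GF n : divides (G n) (F n) by rewrite F_prod; apply: divides_prod.
(* Irreducible factors are nonzero, so each has a nonzero truncation once [n] reaches the length of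
   a monomial that occurs in it. *)
have [|N0 F0] := @prod_trunc_neq0 D fs.
  by move=> j j_fs; have [[jP _] j0 _ _] := irr j j_fs; split=> //; apply: fsD.
have {}F0 n : (N0 <= n)%N -> F n != 0 by move=> /F0; rewrite F_prod.
have sF n k : (k <= n)%N -> sub0 n k (F n.+1) = F n.
  move=> kn; apply: sub0_trunc => // m sm.
  by apply: fQ; rewrite filter_ins0 ?sm.
have [n|n _|N1 N01 deg_stable] :=
    @nondec_bounded_stable (fun n => size (homog n (F n))) N0 D.+1.
- by apply: size_homog => m sm Dm; rewrite mcoef_trunc // fD.
- by rewrite -(sF n n) // size_homog_sub0.
have [n N1n|N N1N inter_stable] :=
    @noninc_stable (fun n => inter (@ufd_mpol n) (F n) (F n)) N1.
  have eF := sF n n (leqnn n).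
  rewrite -eF; apply: inter_self_morph; rewrite ?eF ?F0 ?(leq_trans N01) //.
  by move=> a; apply: sub0_unit; rewrite eF ?F0 ?(leq_trans N01) // deg_stable.
have inj n k a b : (N <= n)%N -> (k <= n)%N -> divides a (F n.+1) ->
    divides b (F n.+1) -> sub0 n k a = sub0 n k b -> a = b.
  move=> Nn kn; have N1n := leq_trans N1N Nn.
  apply: sub0_divisor_inj; rewrite sF ?F0 ?(leq_trans N01) //.
    exact: deg_stable.
  exact: inter_stable.
(* The bound on [n] is strict because the induction step cancels a substitution one level lower. *)
have sG n k : (N < n)%N -> (k <= n)%N -> sub0 n k (G n.+1) = G n.
  move=> Nn kn; rewrite -(subKn kn); elim: (n - k)%N (leq_subr k n) => [|j IH] jn.
    by rewrite subn0; apply: sub0_trunc_last.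
  case: n Nn {kn} jn IH => // n Nn jn IH.
  have kn : (n.+1 - j.+1 <= n)%N by rewrite subSS leq_subr.
  (* Both sides divide [F n.+1], the left one because [sub0] maps the factorization of [F n.+2] to
     one of [F n.+1]. So it is enough to compare their images. *)
  apply: (inj n (n.+1 - j.+1)%N) => //.
    have [c def_F] := GF n.+2; exists (sub0 n.+1 (n.+1 - j.+1) c).
    by rewrite -rmorphM -def_F sF // leqW.
  rewrite sub0_sub0 // -subSn // subSS IH //; exact: ltnW.
apply: (@QSym_ins0 g N.+1) => // m k Nm km.
have := congr1 (fun p => mcoef p m) (sG _ _ Nm km).
by rewrite mcoef_sub0 // !mcoef_trunc // size_ins0.
Qed.
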